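(* Let $(A,\sigma)$ be an $F$-algebra with involution, $P\in X_F$, and let $\iota_1:F\to L_1$ and $\iota_2:F\to L_2$ be two real closures of $F$ at $P$. Let $\mathscr{M}_1:\mathscr{H}(A\otimes_F L_1,\sigma\otimes\mathrm{id})\to\mathscr{H}_{\varepsilon_1}(D_1,\vartheta_1)$ be a Morita equivalence, and let $\rho:L_1\to L_2$ be the unique isomorphism with $\rho\circ\iota_1=\iota_2$. Then for every $h\in W(A,\sigma)$, $$\mathrm{sign}\,\mathscr{M}_1(h\otimes L_1)=\mathrm{sign}\,\rho(\mathscr{M}_1)(h\otimes L_2),$$ in other words $\mathrm{sign}_{\iota_1}^{\mathscr{M}_1}h=\mathrm{sign}_{\iota_2}^{\rho(\mathscr{M}_1)}h$.
   Context: **Algebras with involution and forms.** $F$ is a formally real field and $X_F$ is its space of orderings. An $F$-algebra with involution is a pair $(A,\sigma)$ with $A$ a finite-dimensional $F$-algebra and $\sigma:A\to A$ an $F$-linear map with $\sigma(xy)=\sigma(y)\sigma(x)$, $\sigma^2=\mathrm{id}$, such that either ($\sigma$ of the first kind) $A$ is simple with centre $F$, or ($\sigma$ of the second kind, or unitary) $A$ is simple with centre a quadratic field extension $F(\sqrt d)$ of $F$ on which $\sigma$ acts nontrivially. If $\sigma$ is of the first kind and $\dim_F A=m^2$, then $\sigma$ is orthogonal (resp. symplectic) if $\{a\in A:\sigma(a)=a\}$ has $F$-dimension $m(m+1)/2$ (resp. $m(m-1)/2$). For $\varepsilon\in\{-1,1\}$, an $\varepsilon$-hermitian form over a ring with involution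 $(A,\sigma)$ is a finitely generated right module $M$ (always projective here) with a biadditive $h:M\times M\to A$ such that $h(xa,yb)=\sigma(a)h(x,y)b$ and $h(y,x)=\varepsilon\sigma(h(x,y))$; hermitian means $\varepsilon=1$. All forms are assumed nonsingular. $\mathscr{H}_\varepsilon(A,\sigma)$ is the category of nonsingular $\varepsilon$-hermitian forms with isometries as morphisms, $W_\varepsilon(A,\sigma)$ the Witt group; the subscript is dropped when $\varepsilon=1$. **Signatures, real closed case.** Let $R$ be real closed. For a symmetric bilinear form over $R$, a hermitian form over $(R(\sqrt{-1}),-)$ (conjugation), or a hermitian form over $((-1,-1)_R,-)$ (quaternion conjugation), diagonalize as $\langle\alpha_1,\dots,\alpha_n\rangle$ with $\alpha_i\in\{-1,1\}$ and put $\mathrm{sign}=\sum\alpha_i$. For skew-symmetric forms over $R$, hermitian forms over $(R\times R,\text{exchange involution }(x,y)\mapsto(y,x))$ and skew-hermitian forms over $((-1,-1)_R,-)$, put $\mathrm{sign}=0$. **$M$-signature.** A real closure of $F$ at $P$ is a field embedding $\iota:F\to F_P$ with $F_P$ real closed, $\iota(P)\subseteq F_P^2$ and $F_P$ algebraic over $\iota(F)$. Tensor products with $F_P$ are along $\iota$. The algebra with involution $(A\otimes_F F_P,\sigma\otimes\mathrm{id})$ is (hermitian) Morita equivalent to $(D_P,\vartheta_P)$, where: if $\sigma$ is of the first kind, $(D_P,\vartheta_P)=(F_P,\mathrm{id})$ or $(H_P,-)$ with $H_P=(-1,-1)_{F_P}$, according to whether $A\otimes_F F_P$ is a matrix algebra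 over $F_P$ or over $H_P$; if $\sigma$ is unitary, $(D_P,\vartheta_P)=(F_P(\sqrt{-1}),-)$ if $d<_P0$ and $(F_P\times F_P,\text{exchange})$ if $d>_P0$. Put $\varepsilon_P=-1$ if one of $\sigma,\vartheta_P$ is orthogonal and the other symplectic ($\mathrm{id}$ on $F_P$ being orthogonal and $-$ on $H_P$ symplectic), $\varepsilon_P=1$ otherwise. A Morita equivalence $\mathscr{M}:\mathscr{H}(A\otimes_F F_P,\sigma\otimes\mathrm{id})\to\mathscr{H}_{\varepsilon_P}(D_P,\vartheta_P)$ is an equivalence of categories given by hermitian Morita theory; it respects isometries, orthogonal sums and hyperbolic forms and induces a group isomorphism of Witt groups, also denoted $\mathscr{M}$. For a hermitian form $h$ over $(A,\sigma)$, $\mathrm{sign}_\iota^{\mathscr{M}}h:=\mathrm{sign}\,\mathscr{M}(h\otimes F_P)$, where $h\otimes F_P=(\mathrm{id}_A\otimes\iota)^*(h)$. **Notation of the claim.** $(D_1,\vartheta_1)$ and $\varepsilon_1$ are $(D_P,\vartheta_P)$ and $\varepsilon_P$ for the real closure $\iota_1:F\to L_1$. The isomorphism $\rho$ extends canonically to $D_1\in\{L_1,(-1,-1)_{L_1},L_1(\sqrt{-1}),L_1\times L_1\}$; put $(D_2,\vartheta_2)=(\rho(D_1),\rho\circ\vartheta_1\circ\rho^{-1})$. Then $\rho(\mathscr{M}_1):\mathscr{H}(A\otimes_F L_2,\sigma\otimes\mathrm{id})\to\mathscr{H}_{\varepsilon_1}(D_2,\vartheta_2)$ is the Morita equivalence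 determined by $\rho(\mathscr{M}_1)\circ(\mathrm{id}\otimes\rho)^*=\rho^*\circ\mathscr{M}_1$. *)

(* Defs.v *)
From HB Require Import structures.
From mathcomp Require Import all_boot all_order all_algebra all_field.
From mathcomp Require Import generic_quotient boolp classical_sets.
From mathcomp Require Import complex ring.

Set Implicit Arguments.
Unset Strict Implicit.
Unset Printing Implicit Defensive.

Import GRing.Theory Num.Theory.

Local Open Scope ring_scope.

Section Tensor.
Local Open Scope quotient_scope.
Variables (R : Type) (M N : zmodType) (ract : M -> R -> M) (lact : R -> N -> N).

Definition balanced (G : zmodType) (b : M -> N -> G) : Prop :=
  [/\ forall n, {morph b^~ n : x y / x + y},
      forall m, {morph b m : x y / x + y}
    & forall m r n, b (ract m r) n = b m (lact r n)].

Definition formal_sum (G : zmodType) (b : M -> N -> G) (s : seq (M * N)) : G :=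
  \sum_(p <- s) b p.1 p.2.

(* Two formal sums of pairs denote the same tensor when no balanced map       *)
(* separates them; by the universal property of the tensor product this is    *)
(* the congruence generated by the usual relations.                           *)
Definition tensor_rel (s t : seq (M * N)) : bool :=
  `[< forall (G : zmodType) (b : M -> N -> G),
        balanced b -> formal_sum b s = formal_sum b t >].

Lemma tensor_rel_refl : reflexive tensor_rel.
Proof. by move=> s; apply/asboolP. Qed.

Lemma tensor_rel_sym : symmetric tensor_rel.
Proof. by move=> s t; apply/asboolP/asboolP => st G b bb; rewrite st. Qed.

Lemma tensor_rel_trans : transitive tensor_rel.
Proof.
by move=> t s u /asboolP st /asboolP tu; apply/asboolP => G b bb; rewrite st ?tu.
Qed.

Canonical tensor_equiv :=
  EquivRel tensor_rel tensor_rel_refl tensor_rel_sym tensor_rel_trans.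

Definition tensor : Type := {eq_quot tensor_equiv}.
HB.instance Definition _ := Choice.on tensor.

Definition class_of_seq (s : seq (M * N)) : tensor := \pi_{eq_quot tensor_equiv} s.
Definition seq_of (t : tensor) : seq (M * N) := repr (t : {eq_quot tensor_equiv}).

Lemma seq_ofK t : class_of_seq (seq_of t) = t.
Proof. exact: reprK. Qed.

Lemma class_of_seqP s t :
  class_of_seq s = class_of_seq t <->
  forall (G : zmodType) (b : M -> N -> G),
    balanced b -> formal_sum b s = formal_sum b t.
Proof. by split=> [/eqquotP/asboolP|H] //; apply/eqquotP/asboolP. Qed.

Definition tlift (G : zmodType) (b : M -> N -> G) (t : tensor) : G :=
  formal_sum b (seq_of t).

Lemma tlift_class (G : zmodType) (b : M -> N -> G) s :
  balanced b -> tlift b (class_of_seq s) = formal_sum b s.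
Proof.
by move=> bb; move: (seq_ofK (class_of_seq s)) => /class_of_seqP; apply.
Qed.

Lemma formal_sum_cat (G : zmodType) (b : M -> N -> G) s t :
  formal_sum b (s ++ t) = formal_sum b s + formal_sum b t.
Proof. exact: big_cat. Qed.

Lemma tensorP (t u : tensor) :
  (forall (G : zmodType) (b : M -> N -> G), balanced b -> tlift b t = tlift b u) ->
  t = u.
Proof.
by move=> tu; rewrite -[t]seq_ofK -[u]seq_ofK; apply/class_of_seqP => G b; exact: tu.
Qed.

Definition tzero : tensor := class_of_seq [::].
Definition tadd (t u : tensor) : tensor := class_of_seq (seq_of t ++ seq_of u).
Definition topp (t : tensor) : tensor :=
  class_of_seq [seq (- p.1, p.2) | p <- seq_of t].

Lemma balancedN (G : zmodType) (b : M -> N -> G) : balanced b ->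
  forall m n, b (- m) n = - b m n.
Proof.
case=> bD _ _ m n.
have b0 : b 0 n = 0 by apply: (addrI (b 0 n)); rewrite -bD !addr0.
by apply: (addrI (b m n)); rewrite -bD !subrr.
Qed.

Lemma tlift_add (G : zmodType) (b : M -> N -> G) : balanced b ->
  forall t u, tlift b (tadd t u) = tlift b t + tlift b u.
Proof. by move=> bb t u; rewrite tlift_class // formal_sum_cat. Qed.

Lemma tlift_zero (G : zmodType) (b : M -> N -> G) : balanced b ->
  tlift b tzero = 0.
Proof. by move=> bb; rewrite tlift_class // /formal_sum big_nil. Qed.

Lemma tlift_opp (G : zmodType) (b : M -> N -> G) : balanced b ->
  forall t, tlift b (topp t) = - tlift b t.
Proof.
move=> bb t; rewrite tlift_class // /tlift /formal_sum big_map -sumrN.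
by apply: eq_bigr => p _ /=; rewrite (balancedN bb).
Qed.

Lemma taddA : associative tadd.
Proof. by move=> t u v; apply: tensorP => G b bb; rewrite !(tlift_add bb) addrA. Qed.
Lemma taddC : commutative tadd.
Proof. by move=> t u; apply: tensorP => G b bb; rewrite !(tlift_add bb) addrC. Qed.
Lemma tadd0 : left_id tzero tadd.
Proof. by move=> t; apply: tensorP => G b bb; rewrite (tlift_add bb) (tlift_zero bb) add0r. Qed.
Lemma taddN : left_inverse tzero topp tadd.
Proof.
by move=> t; apply: tensorP => G b bb;
  rewrite (tlift_add bb) (tlift_zero bb) (tlift_opp bb) addNr.
Qed.

HB.instance Definition _ := GRing.isZmodule.Build tensor taddA taddC tadd0 taddN.

Definition tens (m : M) (n : N) : tensor := class_of_seq [:: (m, n)].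

Lemma tliftE (G : zmodType) (b : M -> N -> G) m n :
  balanced b -> tlift b (tens m n) = b m n.
Proof. by move=> bb; rewrite tlift_class // /formal_sum big_seq1. Qed.

Lemma tliftD (G : zmodType) (b : M -> N -> G) :
  balanced b -> {morph tlift b : t u / t + u}.
Proof. exact: tlift_add. Qed.

Lemma tliftB (G : zmodType) (b : M -> N -> G) :
  balanced b -> zmod_morphism (tlift b).
Proof. by move=> bb t u; rewrite tlift_add // tlift_opp. Qed.

Lemma tensDl m m' n : tens (m + m') n = tens m n + tens m' n.
Proof.
apply: tensorP => G b bb; rewrite (tliftD bb) !(tliftE _ _ bb).
by case: bb => ->.
Qed.

Lemma tensDr m n n' : tens m (n + n') = tens m n + tens m n'.
Proof.
apply: tensorP => G b bb; rewrite (tliftD bb) !(tliftE _ _ bb).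
by case: bb => _ ->.
Qed.

Lemma tensA m r n : tens (ract m r) n = tens m (lact r n).
Proof.
by apply: tensorP => G b bb; rewrite !(tliftE _ _ bb); case: bb => _ _ ->.
Qed.

Lemma tens_balanced : balanced tens.
Proof.
by split=> [n m m'|m n n'|m r n] /=; rewrite ?tensDl ?tensDr ?tensA.
Qed.

Lemma tensE (t : tensor) : t = \sum_(p <- seq_of t) tens p.1 p.2.
Proof.
apply: tensorP => G b bb; rewrite {1}/tlift /formal_sum.
elim: (seq_of t) => [|p s IHs]; first by rewrite !big_nil (tlift_zero bb).
by rewrite !big_cons (tliftD bb) (tliftE _ _ bb) IHs.
Qed.

Lemma tensor_ind (P : tensor -> Prop) :
  P 0 -> (forall m n t, P t -> P (tens m n + t)) -> forall t, P t.
Proof.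
move=> P0 PD t; rewrite [t]tensE; elim: (seq_of t) => [|p s IHs].
  by rewrite big_nil.
by rewrite big_cons; apply: PD.
Qed.

Lemma tensor_ext (G : zmodType) (f g : tensor -> G) :
  {morph f : x y / x + y} -> {morph g : x y / x + y} ->
  (forall m n, f (tens m n) = g (tens m n)) -> f =1 g.
Proof.
move=> fD gD fg; have f0 : f 0 = g 0.
  apply: (addrI (f 0)); rewrite -fD addr0.
  have -> : g 0 = 0 by apply: (addrI (g 0)); rewrite -gD !addr0.
  by rewrite addr0.
by elim/tensor_ind => // m n t IH; rewrite fD gD fg IH.
Qed.

End Tensor.

Section Lift2.
Variables (R R' : Type) (M N M' N' : zmodType).
Variables (ract : M -> R -> M) (lact : R -> N -> N).
Variables (ract' : M' -> R' -> M') (lact' : R' -> N' -> N').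
Variables (G : zmodType) (f : M -> N -> M' -> N' -> G).

Definition tlift2 (t : tensor ract lact) (u : tensor ract' lact') : G :=
  tlift (fun m n => tlift (f m n) u) t.

Hypothesis fl : forall m' n', balanced ract lact (fun m n => f m n m' n').
Hypothesis fr : forall m n, balanced ract' lact' (f m n).

Lemma tlift2_balanced (u : tensor ract' lact') : balanced ract lact (fun m n => tlift (f m n) u).
Proof.
split=> [n m1 m2|m n1 n2|m r n] /=; elim/tensor_ind: u => [|m' n' u IHu].
- by rewrite !(tlift_zero (fr _ _)) addr0.
- rewrite !(tliftD (fr _ _)) IHu !(tliftE _ _ (fr _ _)).
  by case: (fl m' n') => -> _ _; rewrite addrACA.
- by rewrite !(tlift_zero (fr _ _)) addr0.
- rewrite !(tliftD (fr _ _)) IHu !(tliftE _ _ (fr _ _)).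
  by case: (fl m' n') => _ -> _; rewrite addrACA.
- by rewrite !(tlift_zero (fr _ _)).
- rewrite !(tliftD (fr _ _)) IHu !(tliftE _ _ (fr _ _)).
  by case: (fl m' n') => _ _ ->.
Qed.

Lemma tlift2E m n m' n' :
  tlift2 (tens ract lact m n) (tens ract' lact' m' n') = f m n m' n'.
Proof. by rewrite /tlift2 tliftE ?tliftE //; exact: tlift2_balanced. Qed.

Lemma tlift2Dl (u : tensor ract' lact') : {morph tlift2^~ u : t t' / t + t'}.
Proof. by move=> t t'; rewrite /tlift2 tliftD //; exact: tlift2_balanced. Qed.

Lemma tlift2Dr (t : tensor ract lact) : {morph tlift2 t : u u' / u + u'}.
Proof.
move=> u u'; rewrite /tlift2.
elim/tensor_ind: t => [|m n t IHt]; first by rewrite !tlift_zero ?addr0 //; apply: tlift2_balanced.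
rewrite !(tliftD (tlift2_balanced _)) IHt !(tliftE _ _ (tlift2_balanced _)).
by rewrite (tliftD (fr _ _)) addrACA.
Qed.

End Lift2.

Definition is_involution (R : pzRingType) (s : R -> R) : Prop :=
  [/\ {morph s : x y / x + y}, forall x y, s (x * y) = s y * s x & involutive s].

Record invRing := InvRing {
  inv_ring :> pzRingType;
  invol : inv_ring -> inv_ring;
  involP : is_involution invol
}.
Arguments invol {_} _.

Record invMor (R S : invRing) := InvMor {
  inv_mor :> {rmorphism R -> S};
  inv_morE : forall x, inv_mor (invol x) = invol (inv_mor x)
}.

Section InvRingTheory.
Variable R : invRing.
Lemma involD : {morph @invol R : x y / x + y}. Proof. by case: (involP R). Qed.
Lemma involM (x y : R) : invol (x * y) = invol y * invol x.
Proof. by case: (involP R) => _ ->. Qed.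
Lemma involK : involutive (@invol R). Proof. by case: (involP R). Qed.
Lemma invol0 : invol (0 : R) = 0.
Proof. by apply: (addrI (invol (0 : R))); rewrite -involD !addr0. Qed.
Lemma involN (x : R) : invol (- x) = - invol x.
Proof. by apply: (addrI (invol x)); rewrite -involD !subrr invol0. Qed.
Lemma invol1 : invol (1 : R) = 1.
Proof. by rewrite -[LHS]mul1r -{1}(involK 1) -involM mul1r involK. Qed.
Lemma invol_sum I (r : seq I) (F : I -> R) :
  invol (\sum_(i <- r) F i) = \sum_(i <- r) invol (F i).
Proof. exact: (big_morph _ involD invol0). Qed.
Lemma involS e (x : R) : invol ((-1) ^+ nat_of_bool e * x) = (-1) ^+ e * invol x.
Proof. by case: e; rewrite ?expr1 ?expr0 ?mulN1r ?mul1r ?involN. Qed.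
End InvRingTheory.

Section ScalarExtension.
Variables (F : fieldType) (A : algType F) (L : comPzRingType).
Variable iota : {rmorphism F -> L}.

Definition scalext : Type :=
  tensor (fun (a : A) (c : F) => c *: a) (fun (c : F) (x : L) => iota c * x).
HB.instance Definition _ := GRing.Zmodule.on scalext.

Definition pure (a : A) (x : L) : scalext := tens _ _ a x.

Lemma pureDl a b x : pure (a + b) x = pure a x + pure b x.
Proof. exact: tensDl. Qed.
Lemma pureDr a x y : pure a (x + y) = pure a x + pure a y.
Proof. exact: tensDr. Qed.
Lemma pureA c a x : pure (c *: a) x = pure a (iota c * x).
Proof. exact: tensA. Qed.

Definition semul : scalext -> scalext -> scalext :=
  tlift2 (fun a x b y => pure (a * b) (x * y)).

Let ml b y :
  balanced (fun (a : A) (c : F) => c *: a) (fun (c : F) (x : L) => iota c * x)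
    (fun a x => pure (a * b) (x * y)).
Proof.
split=> [x a a'|a x x'|a c x]; rewrite ?mulrDl ?pureDl ?pureDr //.
by rewrite -scalerAl pureA mulrA.
Qed.

Let mr a x :
  balanced (fun (a : A) (c : F) => c *: a) (fun (c : F) (x : L) => iota c * x)
    (fun b y => pure (a * b) (x * y)).
Proof.
split=> [y b b'|b y y'|b c y]; rewrite ?mulrDr ?pureDl ?pureDr //.
by rewrite -scalerAr pureA mulrCA.
Qed.

Lemma semulE a x b y : semul (pure a x) (pure b y) = pure (a * b) (x * y).
Proof. by rewrite /semul tlift2E //. Qed.
Lemma semulDl : left_distributive semul +%R.
Proof. by move=> t t' u; rewrite /semul tlift2Dl. Qed.
Lemma semulDr : right_distributive semul +%R.
Proof. by move=> t u u'; rewrite /semul tlift2Dr. Qed.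

Lemma scalext_ext (B : zmodType) (f g : scalext -> B) :
  {morph f : x y / x + y} -> {morph g : x y / x + y} ->
  (forall a x, f (pure a x) = g (pure a x)) -> f =1 g.
Proof. exact: tensor_ext. Qed.

Lemma semulA : associative semul.
Proof.
move=> t u v; move: t; apply: scalext_ext => [t t'|t t'|a x];
  rewrite ?semulDl //.
move: u; apply: scalext_ext => [u u'|u u'|b y]; rewrite ?semulDl ?semulDr ?semulDl //.
move: v; apply: scalext_ext => [v v'|v v'|c z]; rewrite ?semulDr //.
by rewrite !semulE !mulrA.
Qed.

Lemma semul1 : left_id (pure 1 1) semul.
Proof.
by apply: scalext_ext => // [t t'|a x]; rewrite ?semulDr // semulE !mul1r.
Qed.
Lemma semulr1 : right_id (pure 1 1) semul.
Proof.
by apply: scalext_ext => // [t t'|a x]; rewrite ?semulDl // semulE !mulr1.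
Qed.

HB.instance Definition _ :=
  GRing.Zmodule_isPzRing.Build scalext semulA semul1 semulr1 semulDl semulDr.

Lemma pureM a x b y : pure a x * pure b y = pure (a * b) (x * y).
Proof. exact: semulE. Qed.
Lemma pure1 : pure 1 1 = 1. Proof. by []. Qed.

End ScalarExtension.

Section Simple.
Variables (F : fieldType) (A : falgType F).

Definition simple_alg : Prop :=
  forall I : {vspace A},
    (fullv * I <= I)%VS -> (I * fullv <= I)%VS -> I = 0%VS \/ I = fullv.

Definition first_kind : Prop := simple_alg /\ ('Z(fullv) = 1 :> {vspace A})%VS.

(* The centre is F(sqrt d), generated by an element s with s ^+ 2 = d.        *)
Definition second_kind (sigma : A -> A) (d : F) : Prop :=
  [/\ simple_alg,
      forall c : F, c ^+ 2 != d,
      exists s : A, s ^+ 2 = d%:A /\ ('Z(fullv) = 1 + <[s]> :> {vspace A})%VS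
    & exists2 z : A, z \in ('Z(fullv) : {vspace A})%VS & sigma z != z].
End Simple.

Record algInvol (F : fieldType) := AlgInvol {
  ai_alg :> falgType F;
  ai_inv : {linear ai_alg -> ai_alg};
  ai_invM : forall x y, ai_inv (x * y) = ai_inv y * ai_inv x;
  ai_invK : involutive ai_inv;
  ai_kind : first_kind ai_alg \/ exists d, second_kind ai_inv d
}.
Arguments ai_inv {F} _.

Lemma ai_is_involution (F : fieldType) (A : algInvol F) : is_involution (ai_inv A).
Proof. by split; [exact: raddfD|exact: ai_invM|exact: ai_invK]. Qed.

Definition ai_invRing (F : fieldType) (A : algInvol F) : invRing :=
  InvRing (ai_is_involution A).

Section ScalarExtensionInvolution.
Variables (F : fieldType) (A : algInvol F) (L : comPzRingType).
Variable iota : {rmorphism F -> L}.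

Definition ext_inv : scalext A iota -> scalext A iota :=
  tlift (fun a x => pure iota (ai_inv A a) x).

Let bal : balanced (fun (a : A) (c : F) => c *: a) (fun (c : F) (x : L) => iota c * x)
   (fun a x => pure iota (ai_inv A a) x).
Proof.
by split=> [x a a'|a x x'|a c x] /=;
  rewrite ?linearD ?linearZ ?pureDl ?pureDr ?pureA.
Qed.

Lemma ext_invE a x : ext_inv (pure iota a x) = pure iota (ai_inv A a) x.
Proof. by rewrite /ext_inv /pure tliftE. Qed.

Lemma ext_invP : is_involution ext_inv.
Proof.
have D : {morph ext_inv : x y / x + y} by move=> x y; rewrite /ext_inv tliftD.
split=> //.
- move=> t u; move: t; apply: scalext_ext => [t t'|t t'|a x].
  + by rewrite mulrDl D.
  + by rewrite D mulrDr.
  move: u; apply: scalext_ext => [u u'|u u'|b y].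
  + by rewrite mulrDr D.
  + by rewrite D mulrDl.
  by rewrite pureM !ext_invE pureM ai_invM mulrC.
- apply: scalext_ext => // [t t'|a x]; first by rewrite !D.
  by rewrite !ext_invE ai_invK.
Qed.

(* (A ⊗_F L, sigma ⊗ id) *)
Definition ext_invRing : invRing := InvRing ext_invP.

(* id_A ⊗ iota : A = A ⊗_F F -> A ⊗_F L *)
Definition ext_map (a : ai_invRing A) : ext_invRing := pure iota a 1.

Fact ext_map_zmod : zmod_morphism ext_map.
Proof.
move=> a b; apply: (addIr (ext_map b)); rewrite subrK /ext_map -pureDl subrK.
by [].
Qed.
Fact ext_map_monoid : monoid_morphism ext_map.
Proof. by split=> // a b; rewrite /ext_map /= pureM mulr1. Qed.
HB.instance Definition _ := GRing.isZmodMorphism.Build _ _ ext_map ext_map_zmod.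
HB.instance Definition _ := GRing.isMonoidMorphism.Build _ _ ext_map ext_map_monoid.

Definition ext_mor : invMor (ai_invRing A) ext_invRing.
Proof.
by exists ext_map => a; rewrite /= /ext_map ext_invE.
Defined.

End ScalarExtensionInvolution.

Section ScalarExtensionMap.
Variables (F : fieldType) (A : algInvol F) (L1 L2 : comPzRingType).
Variables (iota1 : {rmorphism F -> L1}) (iota2 : {rmorphism F -> L2}).
Variable rho : {rmorphism L1 -> L2}.
Hypothesis rho_iota : rho \o iota1 =1 iota2.

(* id_A ⊗ rho *)
Definition idtens : ext_invRing A iota1 -> ext_invRing A iota2 :=
  tlift (fun a x => pure iota2 a (rho x)).

Let bal : balanced (fun (a : A) (c : F) => c *: a) (fun (c : F) (x : L1) => iota1 c * x)
   (fun a x => pure iota2 a (rho x)).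
Proof.
split=> [x a a'|a x x'|a c x] /=; rewrite ?rmorphD ?rmorphM ?pureDl ?pureDr ?pureA //.
by rewrite -[rho (iota1 c)]/((rho \o iota1) c) rho_iota.
Qed.

Lemma idtensE a x : idtens (pure iota1 a x) = pure iota2 a (rho x).
Proof. by rewrite /idtens /pure tliftE. Qed.

Fact idtensD : {morph idtens : x y / x + y}.
Proof. by move=> x y; rewrite /idtens tliftD. Qed.

Fact idtens_zmod : zmod_morphism idtens.
Proof. by move=> x y; rewrite /idtens tliftB. Qed.

Fact idtens_monoid : monoid_morphism idtens.
Proof.
split; first by rewrite -[X in idtens X]pure1 idtensE rmorph1 pure1.
move=> t u; move: t; apply: scalext_ext => [t t'|t t'|a x].
- by rewrite mulrDl idtensD.
- by rewrite idtensD mulrDl.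
move: u; apply: scalext_ext => [u u'|u u'|b y].
- by rewrite mulrDr idtensD.
- by rewrite idtensD mulrDr.
by rewrite pureM !idtensE pureM rmorphM.
Qed.

Fact idtens_inv x : idtens (invol x) = invol (idtens x).
Proof.
have [DA _ _] := ext_invP A iota1; have [DA' _ _] := ext_invP A iota2.
move: x; apply: scalext_ext => [t t'|t t'|a x]; rewrite /= ?DA ?DA' ?idtensD ?DA' //.
by rewrite ext_invE !idtensE ext_invE.
Qed.

Definition idtens_mor : invMor (ext_invRing A iota1) (ext_invRing A iota2) :=
  let f := GRing.isZmodMorphism.Build _ _ idtens idtens_zmod in
  let g := GRing.isMonoidMorphism.Build _ _ idtens idtens_monoid in
  let m : {rmorphism ext_invRing A iota1 -> ext_invRing A iota2} :=
     HB.pack idtens f g in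
  @InvMor (ext_invRing A iota1) (ext_invRing A iota2) m idtens_inv.

End ScalarExtensionMap.

(* Right R-modules are left modules over the converse ring R^c: r *: x is the *)
(* right multiple x r, and R^c^o is R as a right module over itself.          *)
Section Modules.
Variable R : pzRingType.
Implicit Type M : lmodType R^c.

Definition fin_gen M : Prop :=
  exists n (m : 'I_n -> M), forall x, exists c : 'I_n -> R^c, x = \sum_i c i *: m i.

Definition projective M : Prop :=
  forall (X Y : lmodType R^c) (g : {linear X -> Y}) (f : {linear M -> Y}),
    (forall y, exists x, g x = y) ->
    exists f' : {linear M -> X}, forall x, g (f' x) = f x.
End Modules.

(* The boolean e encodes the sign eps = (-1) ^+ e, so true stands for -1.     *)
Section Forms.
Variables (R : invRing) (e : bool).

Definition eps_hermitian (M : lmodType R^c) (h : M -> M -> R) : Prop :=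
  [/\ forall y, {morph h^~ y : x x' / x + x'},
      forall x, {morph h x : y y' / y + y'},
      forall x y (a b : R), h ((a : R^c) *: x) ((b : R^c) *: y) = invol a * h x y * b
    & forall x y, h y x = (-1) ^+ e * invol (h x y)].

(* x |-> h x - is a bijection from M to Hom_R(M, R) *)
Definition nonsingular (M : lmodType R^c) (h : M -> M -> R) : Prop :=
  (forall x, (forall y, h x y = 0) -> x = 0) /\
  (forall f : {linear M -> R^c^o}, exists x, forall y, h x y = f y).

Record herm := Herm {
  hmod :> lmodType R^c;
  hform : hmod -> hmod -> R;
  hermP : eps_hermitian hform;
  herm_fg : fin_gen hmod;
  herm_proj : projective hmod;
  herm_ns : nonsingular hform
}.

Record isometry (M N : herm) := Isometry {
  iso_map :> {linear M -> N};
  iso_bij : bijective iso_map;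
  iso_form : forall x y, hform (iso_map x) (iso_map y) = hform x y
}.

Section Theory.
Variables (M : lmodType R^c) (h : M -> M -> R).
Hypothesis hP : eps_hermitian h.

Lemma ehDl y : {morph h^~ y : x x' / x + x'}. Proof. by case: hP. Qed.
Lemma ehDr x : {morph h x : y y' / y + y'}. Proof. by case: hP. Qed.
Lemma ehZ x y (a b : R) :
  h ((a : R^c) *: x) ((b : R^c) *: y) = invol a * h x y * b.
Proof. by case: hP. Qed.
Lemma ehC x y : h y x = (-1) ^+ e * invol (h x y). Proof. by case: hP. Qed.
Lemma ehZl x y (a : R) : h ((a : R^c) *: x) y = invol a * h x y.
Proof. by rewrite -{1}[y]scale1r ehZ mulr1. Qed.
Lemma ehZr x y (b : R) : h x ((b : R^c) *: y) = h x y * b.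
Proof. by rewrite -{1}[x]scale1r ehZ invol1 mul1r. Qed.
Lemma eh0r x : h x 0 = 0.
Proof. by apply: (addrI (h x 0)); rewrite -ehDr !addr0. Qed.
Lemma eh0l y : h 0 y = 0.
Proof. by apply: (addrI (h 0 y)); rewrite -ehDl !addr0. Qed.
Lemma eh_sumr x I (r : seq I) (G : I -> M) :
  h x (\sum_(i <- r) G i) = \sum_(i <- r) h x (G i).
Proof. exact: (big_morph _ (ehDr x) (eh0r x)). Qed.
Lemma eh_suml y I (r : seq I) (G : I -> M) :
  h (\sum_(i <- r) G i) y = \sum_(i <- r) h (G i) y.
Proof. exact: (big_morph _ (ehDl y) (eh0l y)). Qed.

Definition dual_family n (p q : 'I_n -> M) : Prop :=
  forall x, x = \sum_i (h (q i) x : R^c) *: p i.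

Lemma dual_family_fg n p q : @dual_family n p q -> fin_gen M.
Proof. by move=> pq; exists n, p => x; exists (fun i => h (q i) x); exact: pq. Qed.

Lemma dual_family_proj n p q : @dual_family n p q -> projective M.
Proof.
move=> pq X Y g f gs.
have /choice [y yP] : forall i, exists y, g y = f (p i) by move=> i; exact: gs.
pose f' x : X := \sum_i (h (q i) x : R^c) *: y i.
have f'L : linear f'.
  move=> a x x'; rewrite /f' scaler_sumr -big_split /=; apply: eq_bigr => i _.
  by rewrite ehDr ehZr scalerDl scalerA.
pose lf := GRing.isLinear.Build _ _ _ _ f' f'L.
pose F : {linear M -> X} := HB.pack f' lf.
exists F => x; rewrite {2}[x](pq x) !linear_sum; apply: eq_bigr => i _.
by rewrite !linearZ yP.
Qed.

Lemma dual_family_ns n p q : @dual_family n p q -> nonsingular h.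
Proof.
move=> pq; split=> [x x0|f].
  have x0' y : h y x = 0.
    by rewrite (ehC x y) x0 invol0 mulr0.
  by rewrite (pq x) big1 // => i _; rewrite x0' scale0r.
exists (\sum_i (invol (f (p i) : R) : R^c) *: q i) => y.
rewrite {2}[y](pq y) linear_sum eh_suml; apply: eq_bigr => i _.
by rewrite ehZl involK linearZ.
Qed.

Lemma dual_familyP : fin_gen M -> projective M -> nonsingular h ->
  exists n p q, @dual_family n p q.
Proof.
move=> [n [p pg]] pr [_ ns].
pose g (v : 'rV[R^c]_n) := \sum_i v 0 i *: p i.
have gL : linear g.
  move=> a v w; rewrite /g scaler_sumr -big_split /=; apply: eq_bigr => i _.
  by rewrite !mxE scalerDl scalerA.
pose lg := GRing.isLinear.Build _ _ _ _ g gL.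
pose G : {linear 'rV[R^c]_n -> M} := HB.pack g lg.
have Gs y : exists x, G x = y.
  by case: (pg y) => c ->; exists (\row_i c i); apply: eq_bigr => i _; rewrite mxE.
have [s sP] := pr _ _ G idfun Gs.
have /choice [q qP] : forall i, exists x, forall y, h x y = s y 0 i.
  move=> i; pose f (y : M) : R^c^o := s y 0 i.
  have fL : linear f by move=> a x y; rewrite /f linearP !mxE.
  pose lf := GRing.isLinear.Build _ _ _ _ f fL.
  pose fF : {linear M -> R^c^o} := HB.pack f lf.
  by have [x xP] := ns fF; exists x => y; rewrite xP.
by exists n, p, q => x; rewrite -{1}[x]sP /= /g; apply: eq_bigr => i _; rewrite qP.
Qed.
End Theory.

End Forms.
Arguments hform {R e} _ _ _.
Arguments hermP {R e} _.
Arguments herm_fg {R e} _.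
Arguments herm_proj {R e} _.
Arguments herm_ns {R e} _.

Section Isometries.
Variables (R : invRing) (e : bool).
Implicit Types M N : herm R e.

Definition iso_id M : isometry M M.
Proof. by exists idfun; [exists idfun|]. Defined.

Definition iso_comp M N K (g : isometry N K) (f : isometry M N) : isometry M K.
Proof.
exists (g \o f : {linear M -> K}).
  by apply: bij_comp; exact: iso_bij.
by move=> x y /=; rewrite !iso_form.
Defined.

Lemma iso_inverse M N (f : isometry M N) :
  exists g : isometry N M, cancel f g /\ cancel g f.
Proof.
case: (iso_bij f) => g gK fK.
have gL : linear g by move=> a x y; apply: (can_inj gK); rewrite linearP !fK.
pose lg := GRing.isLinear.Build _ _ _ _ g gL.
pose G : {linear N -> M} := HB.pack g lg.
have Gb : bijective G by exists f.
have Gf x y : hform M (G x) (G y) = hform N x y by rewrite -(iso_form f) !fK.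
by exists (Isometry Gb Gf).
Qed.

Definition isometric M N : Prop := inhabited (isometry M N).
End Isometries.

Record hfunctor (R S : invRing) (e e' : bool) := HFunctor {
  fobj :> herm R e -> herm S e';
  fmap : forall M N, isometry M N -> isometry (fobj M) (fobj N);
  fmap_ext : forall M N (f g : isometry M N), f =1 g -> fmap f =1 fmap g;
  fmap_id : forall M, fmap (iso_id M) =1 id;
  fmap_comp : forall M N K (g : isometry N K) (f : isometry M N),
    fmap (iso_comp g f) =1 fmap g \o fmap f
}.
Arguments fmap {R S e e'} _ {M N} _.

Definition hf_comp R S T e e' e'' (G : hfunctor S T e' e'') (F : hfunctor R S e e') :
  hfunctor R T e e''.
Proof.
exists (fun M => G (F M)) (fun M N f => fmap G (fmap F f)).
- by move=> M N f g fg; apply: fmap_ext; exact: fmap_ext.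
- move=> M x; rewrite -[RHS](@fmap_id _ _ _ _ G); apply: fmap_ext; exact: fmap_id.
- move=> M N K g f x; rewrite -[RHS]fmap_comp.
  by apply: fmap_ext; exact: fmap_comp.
Defined.

Definition nat_isometric R S e e' (G G' : hfunctor R S e e') : Prop :=
  exists eta : forall M, isometry (G M) (G' M),
    forall M N (f : isometry M N) x, eta N (fmap G f x) = fmap G' f (eta M x).

(* An (R, S)-bimodule N with a form in H_e0(S), R acting on the left by right *)
(* S-linear endomorphisms so that invol r is the adjoint of r.                *)
Record hbimod (R S : invRing) (e0 : bool) := HBimod {
  hb_form :> herm S e0;
  lact : R -> hb_form -> hb_form;
  lactD : forall r, {morph lact r : x y / x + y};
  lactDl : forall x, {morph lact^~ x : r r' / r + r'};
  lactM : forall r r' x, lact (r * r') x = lact r (lact r' x);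
  lact1 : forall x, lact 1 x = x;
  lactZ : forall r (s : S^c) x, lact r (s *: x) = s *: lact r x;
  lact_adj : forall r x y, hform hb_form (lact r x) y = hform hb_form x (lact (invol r) y)
}.
Arguments lact {R S e0} _ _ _.

Section TensorForm.
Variables (R S : invRing) (e e0 e1 : bool) (e1E : e1 = e (+) e0).
Variable N : hbimod R S e0.

Section Object.
Variable M : herm R e.

Definition mract (m : M) (r : R) : M := (r : R^c) *: m.

Definition mtens : Type := tensor mract (lact N).
HB.instance Definition _ := GRing.Zmodule.on mtens.
Definition mt (m : M) (n : N) : mtens := tens _ _ m n.

Lemma mtDl m m' n : mt (m + m') n = mt m n + mt m' n. Proof. exact: tensDl. Qed.
Lemma mtDr m n n' : mt m (n + n') = mt m n + mt m n'. Proof. exact: tensDr. Qed.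
Lemma mtA m (r : R) n : mt ((r : R^c) *: m) n = mt m (lact N r n).
Proof. exact: (tensA mract). Qed.

Lemma mtens_ext (B : zmodType) (f g : mtens -> B) :
  {morph f : x y / x + y} -> {morph g : x y / x + y} ->
  (forall m n, f (mt m n) = g (mt m n)) -> f =1 g.
Proof. exact: tensor_ext. Qed.

Definition mscale (s : S^c) : mtens -> mtens := tlift (fun m n => mt m (s *: n)).

Lemma mscale_bal s : balanced mract (lact N) (fun m n => mt m (s *: n)).
Proof.
split=> [n m m'|m n n'|m r n] /=.
- by rewrite mtDl.
- by rewrite scalerDr mtDr.
- by rewrite mtA lactZ.
Qed.

Lemma mscaleE s m n : mscale s (mt m n) = mt m (s *: n).
Proof. by rewrite /mscale /mt (tliftE _ _ (mscale_bal s)). Qed.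
Lemma mscaleDr : right_distributive mscale +%R.
Proof. by move=> s x y; rewrite /mscale (tliftD (mscale_bal s)). Qed.
Lemma mscaleDl v : {morph mscale^~ v : a b / a + b}.
Proof.
move=> a b /=; move: v; apply: mtens_ext => [x y|x y|m n].
- by rewrite mscaleDr.
- by rewrite !mscaleDr addrACA.
by rewrite !mscaleE scalerDl mtDr.
Qed.
Lemma mscaleA a b v : mscale a (mscale b v) = mscale (a * b) v.
Proof.
move: v; apply: mtens_ext => [x y|x y|m n]; rewrite ?mscaleDr //.
by rewrite !mscaleE scalerA.
Qed.
Lemma mscale1 : left_id 1 mscale.
Proof.
by apply: mtens_ext => [x y||m n]; rewrite ?mscaleDr // mscaleE scale1r.
Qed.

HB.instance Definition _ :=
  GRing.Zmodule_isLmodule.Build S^c mtens mscaleA mscale1 mscaleDr mscaleDl.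

Lemma mtZ (s : S^c) m n : s *: mt m n = mt m (s *: n).
Proof. exact: mscaleE. Qed.

Definition mtform : mtens -> mtens -> S :=
  tlift2 (fun m n m' n' => hform N n (lact N (hform M m m') n')).

Let hN := hermP N.
Let hM := hermP M.

Lemma mtform_ball m' n' : balanced mract (lact N)
  (fun m n => hform N n (lact N (hform M m m') n')).
Proof.
split=> [n m m1|m n n1|m r n] /=.
- by rewrite (ehDl hM) lactDl (ehDr hN).
- by rewrite (ehDl hN).
- by rewrite /mract (ehZl hM) lactM lact_adj.
Qed.
Lemma mtform_balr m n : balanced mract (lact N)
  (fun m' n' => hform N n (lact N (hform M m m') n')).
Proof.
split=> [n' m' m1|m' n' n1|m' r n'] /=.
- by rewrite (ehDr hM) lactDl (ehDr hN).
- by rewrite lactD (ehDr hN).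
- by rewrite /mract (ehZr hM) lactM.
Qed.

Lemma mtformE m n m' n' :
  mtform (mt m n) (mt m' n') = hform N n (lact N (hform M m m') n').
Proof. by apply: tlift2E; [exact: mtform_ball|exact: mtform_balr]. Qed.
Lemma mtformDl u : {morph mtform^~ u : t t' / t + t'}.
Proof. by apply: tlift2Dl; [exact: mtform_ball|exact: mtform_balr]. Qed.
Lemma mtformDr t : {morph mtform t : u u' / u + u'}.
Proof. by apply: tlift2Dr; [exact: mtform_ball|exact: mtform_balr]. Qed.

Lemma lact_sign (b : bool) x :
  lact N ((-1) ^+ b) x = (((-1) ^+ b : S) : S^c) *: x.
Proof.
have lact0 : lact N 0 x = 0.
  by apply: (addrI (lact N 0 x)); rewrite -lactDl !addr0.
case: b; rewrite ?expr0 ?lact1; last by rewrite -[RHS]/((1 : S^c) *: x) scale1r.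
rewrite !expr1 -[RHS]/((-1 : S^c) *: x) scaleN1r.
by apply: (addrI x); rewrite subrr -{1}[x]lact1 -lactDl subrr.
Qed.

Lemma mtform_herm : eps_hermitian e1 mtform.
Proof.
split.
- exact: mtformDl.
- exact: mtformDr.
- move=> x y a b; move: x; apply: mtens_ext => [x x'|x x'|m n].
  + by rewrite scalerDr mtformDl.
  + by rewrite mtformDl mulrDr mulrDl.
  move: y; apply: mtens_ext => [y y'|y y'|m' n'].
  + by rewrite scalerDr mtformDr.
  + by rewrite mtformDr mulrDr mulrDl.
  by rewrite !mtZ !mtformE lactZ (ehZ hN).
- move=> x y; move: x; apply: mtens_ext => [x x'|x x'|m n].
  + by rewrite mtformDr.
  + by rewrite mtformDl involD mulrDr.
  move: y; apply: mtens_ext => [y y'|y y'|m' n'].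
  + by rewrite mtformDl.
  + by rewrite mtformDr involD mulrDr.
  rewrite !mtformE (ehC hM m m') lactM lact_sign (ehC hN _ n').
  rewrite (ehZl hN) lact_adj involK involM involK e1E signr_addb.
  by rewrite commr_sign mulrA -!exprD addnC.
Qed.

Lemma mt_sumr m I (r : seq I) (G : I -> N) :
  mt m (\sum_(i <- r) G i) = \sum_(i <- r) mt m (G i).
Proof.
have mt0 : mt m 0 = 0 by apply: (addrI (mt m 0)); rewrite -mtDr !addr0.
exact: (big_morph _ (mtDr m) mt0).
Qed.
Lemma mt_suml n I (r : seq I) (G : I -> M) :
  mt (\sum_(i <- r) G i) n = \sum_(i <- r) mt (G i) n.
Proof.
have mt0 : mt 0 n = 0 by apply: (addrI (mt 0 n)); rewrite -mtDl !addr0.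
exact: (big_morph _ (fun m m' => mtDl m m' n) mt0).
Qed.

Lemma mtform_dual :
  exists n (p q : 'I_n -> mtens), dual_family mtform p q.
Proof.
have [k [p [q pq]]] := dual_familyP (herm_fg M) (herm_proj M) (herm_ns M).
have [l [u [v uv]]] := dual_familyP (herm_fg N) (herm_proj N) (herm_ns N).
pose I : finType := ('I_k * 'I_l)%type.
exists #|I|, (fun i => mt (p (enum_val i).1) (u (enum_val i).2)),
  (fun i => mt (q (enum_val i).1) (v (enum_val i).2)).
apply: mtens_ext => // [x y|m n].
  by rewrite -big_split; apply: eq_bigr => i _; rewrite mtformDr scalerDl.
pose G (i : I) := (mtform (mt (q i.1) (v i.2)) (mt m n) : S^c) *:
  mt (p i.1) (u i.2).
transitivity (\sum_(i : I) G i); last first.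
  by rewrite (reindex (@enum_val I I)) //; apply: onW_bij; exact: enum_val_bij.
rewrite -(pair_bigA _ (fun i j => G (i, j))) /= {1}[m](pq m) mt_suml.
apply: eq_bigr => i _; rewrite mtA {1}[lact _ _ _](uv _) mt_sumr.
by apply: eq_bigr => j _; rewrite /G mtformE mtZ.
Qed.

Definition mtherm : herm S e1.
Proof.
exists mtens mtform.
- exact: mtform_herm.
- by have [n [p [q pq]]] := mtform_dual; exact: dual_family_fg pq.
- by have [n [p [q pq]]] := mtform_dual; exact: (dual_family_proj mtform_herm pq).
- by have [n [p [q pq]]] := mtform_dual; exact: (dual_family_ns mtform_herm pq).
Defined.
End Object.

Section Map.
Variables (M M' : herm R e) (f : isometry M M').

Definition mtmap : mtherm M -> mtherm M' := tlift (fun m n => mt (f m) n).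

Lemma mtmap_bal : balanced (@mract M) (lact N) (fun m n => mt (f m) n).
Proof.
split=> [n m m'|m n n'|m r n] /=; rewrite ?linearD ?mtDl ?mtDr //.
by rewrite /mract linearZ mtA.
Qed.

Lemma mtmapE m n : mtmap (mt m n) = mt (f m) n.
Proof. by rewrite /mtmap /mt (tliftE _ _ mtmap_bal). Qed.

Lemma mtmapD : {morph mtmap : x y / x + y}.
Proof. by move=> x y; rewrite /mtmap (tliftD mtmap_bal). Qed.

Lemma mtmap_linear : linear mtmap.
Proof.
move=> a x y; rewrite mtmapD; congr (_ + _); move: x.
apply: mtens_ext => [x x'|x x'|m n].
- by rewrite scalerDr mtmapD.
- by rewrite mtmapD scalerDr.
by rewrite mtZ !mtmapE mtZ.
Qed.

Lemma mtmap_form x y : hform (mtherm M') (mtmap x) (mtmap y) = hform (mtherm M) x y.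
Proof.
move: x; apply: mtens_ext => [x x'|x x'|m n].
- by rewrite mtmapD [LHS]mtformDl.
- by rewrite [LHS]mtformDl.
move: y; apply: mtens_ext => [y y'|y y'|m' n'].
- by rewrite mtmapD [LHS]mtformDr.
- by rewrite [LHS]mtformDr.
by rewrite !mtmapE [LHS]mtformE [RHS]mtformE iso_form.
Qed.
End Map.

Lemma mtmap_ext (M M' : herm R e) (f g : isometry M M') : f =1 g -> mtmap f =1 mtmap g.
Proof.
move=> fg; apply: mtens_ext => [x y|x y|m n]; rewrite ?mtmapD //.
by rewrite !mtmapE fg.
Qed.

Lemma mtmap_id (M : herm R e) : mtmap (iso_id M) =1 id.
Proof. by apply: mtens_ext => [x y||m n]; rewrite ?mtmapD // mtmapE. Qed.

Lemma mtmap_comp (M M' K : herm R e) (g : isometry M' K) (f : isometry M M') :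
  mtmap (iso_comp g f) =1 mtmap g \o mtmap f.
Proof.
apply: mtens_ext => [x y|x y|m n]; rewrite /= ?mtmapD //.
by rewrite !mtmapE.
Qed.

Lemma mtmap_bij (M M' : herm R e) (f : isometry M M') : bijective (mtmap f).
Proof.
have [g [fg gf]] := iso_inverse f.
exists (mtmap g) => x.
  rewrite -[LHS]/((mtmap g \o mtmap f) x) -mtmap_comp -[RHS]mtmap_id.
  exact: mtmap_ext.
rewrite -[LHS]/((mtmap f \o mtmap g) x) -mtmap_comp -[RHS]mtmap_id.
exact: mtmap_ext.
Qed.

Definition mtiso (M M' : herm R e) (f : isometry M M') :
  isometry (mtherm M) (mtherm M') :=
  let lf := GRing.isLinear.Build _ _ _ _ (mtmap f) (mtmap_linear f) in
  let F : {linear mtherm M -> mtherm M'} := HB.pack (mtmap f) lf in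
  @Isometry _ _ (mtherm M) (mtherm M') F (mtmap_bij f) (mtmap_form f).

Definition tensor_functor : hfunctor R S e e1 :=
  @HFunctor R S e e1 mtherm mtiso mtmap_ext mtmap_id mtmap_comp.

End TensorForm.

(* f^* for a morphism f : R -> S of rings with involution: base change, that  *)
(* is the tensor product with S, an (R, S)-bimodule through f.                *)
Section BaseChange.
Variables (R S : invRing) (f : invMor R S).

Definition unit_form (x y : S^c^o) : S := invol (x : S) * y.

Lemma unit_form_herm : eps_hermitian false unit_form.
Proof.
rewrite /unit_form; split.
- by move=> y x x'; rewrite involD mulrDl.
- by move=> x y y'; rewrite mulrDr.
- move=> x y a b.
  by rewrite -[LHS]/(invol ((x : S) * a) * ((y : S) * b)) involM !mulrA.
- by move=> x y; rewrite expr0 mul1r involM involK.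
Qed.

Lemma unit_form_dual : exists n (p q : 'I_n -> S^c^o), dual_family unit_form p q.
Proof.
exists 1, (fun=> 1), (fun=> 1) => x; rewrite big_ord1 /unit_form invol1 mul1r.
by rewrite -[RHS]/((1 : S) * x) mul1r.
Qed.

(* The hermitian form <1>: (x, y) |-> invol x * y on S *)
Definition unit_herm : herm S false.
Proof.
exists (S^c^o : lmodType S^c) unit_form.
- exact: unit_form_herm.
- by have [n [p [q pq]]] := unit_form_dual; exact: dual_family_fg pq.
- by have [n [p [q pq]]] := unit_form_dual; exact: (dual_family_proj unit_form_herm pq).
- by have [n [p [q pq]]] := unit_form_dual; exact: (dual_family_ns unit_form_herm pq).
Defined.

Definition bc_hbimod : hbimod R S false.
Proof.
exists unit_herm (fun (r : R) (s : S) => f r * s).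
- by move=> r x y; rewrite mulrDr.
- by move=> x r r' /=; rewrite rmorphD mulrDl.
- by move=> r r' x; rewrite rmorphM mulrA.
- by move=> x; rewrite rmorph1 mul1r.
- by move=> r s x; rewrite -[LHS]/(f r * ((x : S) * s)) mulrA.
- by move=> r x y; rewrite /= /unit_form involM inv_morE mulrA.
Defined.

Definition base_change (e : bool) : hfunctor R S e e :=
  tensor_functor (esym (addbF e)) bc_hbimod.
End BaseChange.

Section OrthogonalSum.
Variables (R : invRing) (e : bool) (M N : herm R e).

Definition osum_form (x y : M * N) : R := hform M x.1 y.1 + hform N x.2 y.2.

Lemma osum_form_herm : eps_hermitian e osum_form.
Proof.
have [hM hN] := (hermP M, hermP N); rewrite /osum_form; split.
- by move=> y x x' /=; rewrite (ehDl hM) (ehDl hN) addrACA.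
- by move=> x y y' /=; rewrite (ehDr hM) (ehDr hN) addrACA.
- by move=> x y a b /=; rewrite (ehZ hM) (ehZ hN) mulrDr mulrDl.
- by move=> x y /=; rewrite (ehC hM) (ehC hN) involD mulrDr.
Qed.

Lemma osum_form_dual :
  exists n (p q : 'I_n -> (M * N)%type), dual_family osum_form p q.
Proof.
have [m [p [q pq]]] := dual_familyP (herm_fg M) (herm_proj M) (herm_ns M).
have [n [u [v uv]]] := dual_familyP (herm_fg N) (herm_proj N) (herm_ns N).
pose l (f : 'I_m -> M) (g : 'I_n -> N) (i : 'I_(m + n)) : M * N :=
  match split i with inl j => (f j, 0) | inr j => (0, g j) end.
exists (m + n)%N, (l p u), (l q v) => x.
have E1 (j : 'I_m) (f : 'I_m -> M) g : l f g (lshift n j) = (f j, 0).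
  by rewrite /l (unsplitK (inl j)).
have E2 (j : 'I_n) (f : 'I_m -> M) g : l f g (rshift m j) = (0, g j).
  by rewrite /l (unsplitK (inr j)).
have h0 := (eh0r (hermP M), eh0r (hermP N), eh0l (hermP M), eh0l (hermP N)).
apply: injective_projections; rewrite raddf_sum big_split_ord /=.
  rewrite [X in _ + X]big1 => [|j _]; last by rewrite !E2 /= scaler0.
  rewrite addr0 {1}[x.1](pq x.1); apply: eq_bigr => j _.
  by rewrite !E1 /osum_form /= h0 addr0.
rewrite [X in X + _]big1 => [|j _]; last by rewrite !E1 /= scaler0.
rewrite add0r {1}[x.2](uv x.2); apply: eq_bigr => j _.
by rewrite !E2 /osum_form /= h0 add0r.
Qed.

(* M ⊥ N *)
Definition osum : herm R e.
Proof.
exists (M * N)%type osum_form.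
- exact: osum_form_herm.
- by have [n [p [q pq]]] := osum_form_dual; exact: dual_family_fg pq.
- by have [n [p [q pq]]] := osum_form_dual; exact: (dual_family_proj osum_form_herm pq).
- by have [n [p [q pq]]] := osum_form_dual; exact: (dual_family_ns osum_form_herm pq).
Defined.
End OrthogonalSum.

Section Witt.
Variables (R : invRing) (e : bool).

(* M is isometric, by x |-> (p x, q x), to the hyperbolic space on U ⊕ U^*,   *)
(* where (phi a) u = invol a * phi u defines the right action on              *)
(* U^* = Hom_R(U, R) and the form maps (u, phi), (v, psi) to                  *)
(* phi v + eps * invol (psi u).                                               *)
Definition hyperbolic (M : herm R e) : Prop :=
  exists (U : lmodType R^c) (p : {linear M -> U}) (q : M -> {linear U -> R^c^o}),
    [/\ fin_gen U, projective U,
        forall (a : R) x y u, q ((a : R^c) *: x + y) u = invol a * (q x u : R) + q y u,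
        forall u (phi : {linear U -> R^c^o}),
          exists! x, p x = u /\ q x =1 phi
      & forall x y,
          hform M x y = (q x (p y) : R) + (-1) ^+ e * invol (q y (p x) : R)].

Definition witt_eq (M N : herm R e) : Prop :=
  exists H H' : herm R e,
    [/\ hyperbolic H, hyperbolic H' & isometric (osum M H) (osum N H')].

(* An element of the Witt group is the Witt class of a form.                  *)
Record witt := Witt {
  witt_class :> herm R e -> Prop;
  wittP : exists M, forall N, witt_class N <-> witt_eq M N
}.
End Witt.

Section Morita.
Variables (R S : invRing) (e0 : bool).

Definition generator (M : lmodType S^c) : Prop :=
  exists n (f : 'I_n -> {linear M -> S^c^o}) (m : 'I_n -> M),
    \sum_i f i (m i) = 1.

(* N is a progenerator over S, R = End_S(N) acting on the left, and the       *)
(* involution of R is the adjoint involution of the form on N (lact_adj).     *)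
Definition morita_bimod (N : hbimod R S e0) : Prop :=
  [/\ generator N,
      forall r : R, (forall x, lact N r x = 0) -> r = 0
    & forall g : {linear N -> N}, exists r : R, forall x, lact N r x = g x].

(* A Morita equivalence is a functor naturally isometric to the functor       *)
(* M |-> M ⊗_R N given by such an N, which is automatically an equivalence of  *)
(* categories.                                                                *)
Record moritaEq := MoritaEq {
  me_functor :> hfunctor R S false e0;
  meP : exists N : hbimod R S e0,
    morita_bimod N /\ nat_isometric me_functor (tensor_functor (e := false) erefl N)
}.
End Morita.

Record quat (R : Type) := Quat { q1 : R; qi : R; qj : R; qk : R }.

Definition quat_prod (R : Type) (x : quat R) := (q1 x, qi x, qj x, qk x).
Definition prod_quat (R : Type) (x : R * R * R * R) :=
  Quat x.1.1.1 x.1.1.2 x.1.2 x.2.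
Lemma quat_prodK R : cancel (@quat_prod R) (@prod_quat R).
Proof. by case. Qed.

HB.instance Definition _ (R : choiceType) :=
  Choice.copy (quat R) (can_type (@quat_prodK R)).

Section QuatRing.
Variable R : comPzRingType.
Implicit Types x y z : quat R.

Definition qzero : quat R := Quat 0 0 0 0.
Definition qone : quat R := Quat 1 0 0 0.
Definition qopp x := Quat (- q1 x) (- qi x) (- qj x) (- qk x).
Definition qadd x y := Quat (q1 x + q1 y) (qi x + qi y) (qj x + qj y) (qk x + qk y).
Definition qmul x y :=
  Quat (q1 x * q1 y - qi x * qi y - qj x * qj y - qk x * qk y)
       (q1 x * qi y + qi x * q1 y + qj x * qk y - qk x * qj y)
       (q1 x * qj y - qi x * qk y + qj x * q1 y + qk x * qi y)
       (q1 x * qk y + qi x * qj y - qj x * qi y + qk x * q1 y).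

Lemma qaddA : associative qadd.
Proof. by move=> x y z; congr Quat; exact: addrA. Qed.
Lemma qaddC : commutative qadd.
Proof. by move=> x y; congr Quat; exact: addrC. Qed.
Lemma qadd0 : left_id qzero qadd.
Proof. by case=> *; congr Quat; exact: add0r. Qed.
Lemma qaddN : left_inverse qzero qopp qadd.
Proof. by move=> x; congr Quat; exact: addNr. Qed.
HB.instance Definition _ := GRing.isZmodule.Build (quat R) qaddA qaddC qadd0 qaddN.

Lemma qmulA : associative qmul.
Proof. by move=> x y z; congr Quat => /=; ring. Qed.
Lemma qmul1 : left_id qone qmul.
Proof. by case=> a b c d; rewrite /qmul /=; congr Quat; ring. Qed.
Lemma qmulr1 : right_id qone qmul.
Proof. by case=> a b c d; rewrite /qmul /=; congr Quat; ring. Qed.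
Lemma qmulDl : left_distributive qmul +%R.
Proof. by move=> x y z; congr Quat => /=; ring. Qed.
Lemma qmulDr : right_distributive qmul +%R.
Proof. by move=> x y z; congr Quat => /=; ring. Qed.
HB.instance Definition _ :=
  GRing.Zmodule_isPzRing.Build (quat R) qmulA qmul1 qmulr1 qmulDl qmulDr.

Definition qconj x : quat R := Quat (q1 x) (- qi x) (- qj x) (- qk x).
Lemma qconjP : is_involution qconj.
Proof.
split=> [x y|x y|x]; first by congr Quat => /=; ring.
  by congr Quat => /=; ring.
by case: x => a b c d; rewrite /qconj /= !opprK.
Qed.
End QuatRing.

Inductive DKind := Dreal | Dquat | Dcomplex | Dsplit.

Section DP.
Variable L : rcfType.

Lemma id_inv : is_involution (@idfun L).
Proof. by split=> // x y; exact: mulrC. Qed.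
Lemma conjc_inv : is_involution (@conjc L).
Proof.
by split=> [x y|x y|]; rewrite ?rmorphD ?rmorphM //; [exact: mulrC|exact: conjcK].
Qed.
Definition exchange (x : L * L) : L * L := (x.2, x.1).
Lemma exchange_inv : is_involution exchange.
Proof. by split=> [x y|x y|[x y]] //; congr pair; exact: mulrC. Qed.

Definition DP (k : DKind) : invRing :=
  match k with
  | Dreal => InvRing id_inv
  | Dquat => InvRing (@qconjP L)
  | Dcomplex => InvRing conjc_inv
  | Dsplit => InvRing exchange_inv
  end.

Definition DP_scalar (k : DKind) : L -> DP k :=
  match k with
  | Dreal => fun x => x
  | Dquat => fun x => Quat x 0 0 0
  | Dcomplex => fun x => Complex x 0
  | Dsplit => fun x => (x, x)
  end.
End DP.

Section DPmap.
Variables (L1 L2 : rcfType) (rho : {rmorphism L1 -> L2}).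

(* The canonical extension of rho to D_P *)
Definition DP_map (k : DKind) : DP L1 k -> DP L2 k :=
  match k with
  | Dreal => rho
  | Dquat => fun x => Quat (rho (q1 x)) (rho (qi x)) (rho (qj x)) (rho (qk x))
  | Dcomplex => fun x => Complex (rho (complex.Re x)) (rho (complex.Im x))
  | Dsplit => fun x => (rho x.1, rho x.2)
  end.

Lemma DP_map_zmod k : zmod_morphism (@DP_map k).
Proof.
case: k => [|x y|[a b] [c d]|x y] /=; first exact: raddfB.
- by congr Quat; rewrite rmorphB.
- by congr Complex; rewrite rmorphB.
- by congr pair; rewrite rmorphB.
Qed.

Lemma DP_map_monoid k : monoid_morphism (@DP_map k).
Proof.
case: k; (split; first by rewrite /= ?rmorph1 ?rmorph0); move=> /=.
- exact: rmorphM.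
- by move=> x y; congr Quat; rewrite /= !(rmorphB, rmorphD, rmorphM).
- by move=> [a b] [c d]; congr Complex; rewrite /= !(rmorphB, rmorphD, rmorphM).
- by move=> x y; congr pair; rewrite rmorphM.
Qed.

Lemma DP_map_inv k x : @DP_map k (invol x) = invol (DP_map x).
Proof.
case: k x => [//|x|[a b]|//]; first by congr Quat; rewrite /= rmorphN.
by congr Complex; rewrite /= rmorphN.
Qed.

(* As DP_map commutes with the involutions, theta_2 = rho theta_1 rho^-1.     *)
Definition DP_mor k : invMor (DP L1 k) (DP L2 k) :=
  let f := GRing.isZmodMorphism.Build _ _ (@DP_map k) (@DP_map_zmod k) in
  let g := GRing.isMonoidMorphism.Build _ _ (@DP_map k) (@DP_map_monoid k) in
  let m : {rmorphism DP L1 k -> DP L2 k} := HB.pack (@DP_map k) f g in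
  @InvMor (DP L1 k) (DP L2 k) m (@DP_map_inv k).

End DPmap.

(* M is isometric to <alpha_1, ..., alpha_n>, alpha_i = (-1) ^+ alpha i       *)
Definition diagonalization (S : invRing) (e : bool) (M : herm S e)
    (n : nat) (alpha : 'I_n -> bool) : Prop :=
  exists phi : {linear M -> 'rV[S^c]_n}, bijective phi /\
    forall x y, hform M x y =
      \sum_i invol (phi x 0 i : S) * (-1) ^+ alpha i * (phi y 0 i : S).

(* By the law of inertia the set below is a singleton. The skew-hermitian     *)
(* forms over (L(sqrt -1), -) do not arise, since eps_P = 1 in that case.     *)
Definition sign (L : rcfType) (k : DKind) (e : bool) (M : herm (DP L k) e) : int :=
  if e || (if k is Dsplit then true else false) then 0
  else xget 0 [set s : int | exists n (alpha : 'I_n -> bool),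
    diagonalization M alpha /\ s = \sum_i (-1) ^+ alpha i].

Definition formally_real (F : fieldType) : Prop :=
  forall s : seq F, \sum_(x <- s) x ^+ 2 != -1.

Record ordering (F : fieldType) := Ordering {
  ord_pos :> F -> Prop;
  ordD : forall x y, ord_pos x -> ord_pos y -> ord_pos (x + y);
  ordM : forall x y, ord_pos x -> ord_pos y -> ord_pos (x * y);
  ord_total : forall x, ord_pos x \/ ord_pos (- x);
  ord_anti : forall x, ord_pos x -> ord_pos (- x) -> x = 0
}.

Definition ord_lt (F : fieldType) (P : ordering F) (x y : F) : Prop :=
  P (y - x) /\ x <> y.

Record realClosure (F : fieldType) (P : ordering F) (L : rcfType) := RealClosure {
  rc_map :> {rmorphism F -> L};
  rc_pos : forall a, P a -> exists b, rc_map a = b ^+ 2;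
  rc_alg : forall x : L, algebraicOver rc_map x
}.

Section InvolutionType.
Variables (F : fieldType) (A : algInvol F).

Definition orthogonal_inv : Prop :=
  first_kind A /\ exists m, \dim {:A} = (m ^ 2)%N /\
    \dim (fixedSpace (linfun (ai_inv A))) = ((m * m.+1)./2)%N.

Definition symplectic_inv : Prop :=
  first_kind A /\ exists m, \dim {:A} = (m ^ 2)%N /\
    \dim (fixedSpace (linfun (ai_inv A))) = ((m * m.-1)./2)%N.

Definition epsP (k : DKind) : bool :=
  `[< (orthogonal_inv /\ k = Dquat) \/ (symplectic_inv /\ k = Dreal) >].

(* A ⊗_F L is isomorphic, as an L-algebra, to a matrix algebra over DP L k.   *)
Definition split_over (L : rcfType) (iota : {rmorphism F -> L}) (k : DKind) : Prop :=
  exists n (f : {rmorphism scalext A iota -> 'M[DP L k]_n}),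
    bijective f /\ forall x : L, f (pure iota 1 x) = (DP_scalar k x)%:M.

(* DP L k is (D_P, theta_P). *)
Definition is_DP (P : ordering F) (L : rcfType) (iota : realClosure P L) (k : DKind)
    : Prop :=
  match k with
  | Dreal | Dquat => first_kind A /\ split_over iota k
  | Dcomplex => exists d, second_kind (ai_inv A) d /\ ord_lt P d 0
  | Dsplit => exists d, second_kind (ai_inv A) d /\ ord_lt P 0 d
  end.
End InvolutionType.

(* h ⊗ L = (id_A ⊗ iota)^* h *)
Definition extend (F : fieldType) (A : algInvol F) (L : rcfType)
    (iota : {rmorphism F -> L}) :
  hfunctor (ai_invRing A) (ext_invRing A iota) false false :=
  base_change (ext_mor A iota) false.

Definition msign (F : fieldType) (A : algInvol F) (P : ordering F) (L : rcfType)
    (iota : realClosure P L) (k : DKind) (e : bool)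
    (M : moritaEq (ext_invRing A iota) (DP L k) e)
    (h : herm (ai_invRing A) false) : int :=
  sign (M (extend A iota h)).

(* rhoM is rho(M), the Morita equivalence with                                *)
(* rho(M) o (id ⊗ rho)^* = rho^* o M, up to natural isometry.                 *)
Definition transports (F : fieldType) (A : algInvol F) (L1 L2 : rcfType)
    (iota1 : {rmorphism F -> L1}) (iota2 : {rmorphism F -> L2})
    (rho : {rmorphism L1 -> L2}) (rho_iota : rho \o iota1 =1 iota2)
    (k : DKind) (e : bool)
    (M : moritaEq (ext_invRing A iota1) (DP L1 k) e)
    (rhoM : moritaEq (ext_invRing A iota2) (DP L2 k) e) : Prop :=
  nat_isometric (hf_comp rhoM (base_change (idtens_mor A rho_iota) false))
                (hf_comp (base_change (DP_mor rho k) e) M).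

(* Main.v *)
(** Base change is transitive, so [h ⊗ L2] is isometric to [(id ⊗ rho)^* (h ⊗ L1)],
    and by definition of [rho(M1)] the form [rho(M1) (h ⊗ L2)] is isometric to
    [rho^* (M1 (h ⊗ L1))].  As [rho] is an isomorphism, [x |-> x ⊗ 1] is a
    semilinear isometry from a form onto its base change, so the two forms have
    the same diagonalizations and hence the same signature. *)

Require Import Defs.
From HB Require Import structures.
From mathcomp Require Import all_boot all_order all_algebra all_field.
From mathcomp Require Import boolp classical_sets.

Set Implicit Arguments.
Unset Strict Implicit.
Unset Printing Implicit Defensive.

Import GRing.Theory.

Local Open Scope ring_scope.

(** * Semilinear isometries and diagonalizations *)

Lemma inj_surj_bij (T U : Type) (f : T -> U) :
  injective f -> (forall y, exists x, f x = y) -> bijective f.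
Proof.
move=> f_inj /choice [g gK]; exists g => // x.
by apply: f_inj; rewrite gK.
Qed.

Definition inv_mor_id (R : invRing) : invMor R R :=
  @InvMor R R idfun (fun=> erefl).

Lemma inv_mor_inverse (R S : invRing) (f : invMor R S) :
  bijective f -> exists g : invMor S R, cancel f g /\ cancel g f.
Proof.
case=> g fK gK.
pose gz := GRing.isZmodMorphism.Build _ _ g (can2_zmod_morphism fK gK).
pose gm := GRing.isMonoidMorphism.Build _ _ g (can2_monoid_morphism fK gK).
pose G : {rmorphism S -> R} := HB.pack g gz gm.
have GI x : G (invol x) = invol (G x).
  by apply: (can_inj fK); rewrite inv_morE !gK.
by exists (InvMor GI).
Qed.

Section SemiIsometry.
Variables (R S : invRing) (e : bool) (f : invMor R S).
Variables (M : herm R e) (M' : herm S e).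

(** Compares forms over different rings without first forming a base change; ordinary isometries are
    the case where [f] is the identity. *)
Definition semi_isometry (j : M -> M') : Prop :=
  [/\ bijective j, {morph j : x y / x + y},
      forall (a : R) x, j ((a : R^c) *: x) = (f a : S^c) *: j x
    & forall x y, hform M' (j x) (j y) = f (hform M x y)].

(* Nonsingularity makes form-preserving maps injective. *)
Lemma semi_isometry_surj (j : M -> M') : injective f ->
  {morph j : x y / x + y} ->
  (forall (a : R) x, j ((a : R^c) *: x) = (f a : S^c) *: j x) ->
  (forall x y, hform M' (j x) (j y) = f (hform M x y)) ->
  (forall y, exists x, j x = y) -> semi_isometry j.
Proof.
move=> f_inj jD jZ jf j_surj; split=> //; apply: inj_surj_bij => // x y jxy.
have [ns _] := herm_ns M.
apply/eqP; rewrite -subr_eq0; apply/eqP/ns => z; apply: f_inj.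
rewrite (ehDl (hermP M)) -scaleN1r (ehZl (hermP M) _ _ (-1)).
by rewrite involN invol1 mulN1r rmorphB -!jf jxy subrr rmorph0.
Qed.

(** Coordinates carry over: apply [f] entrywise to the coordinates under [phi] of the preimage of a
    vector. The diagonal entries are signs, which [f] fixes, and [f] commutes with the
    involutions. *)
Lemma semi_isometry_diag (j : M -> M') n (alpha : 'I_n -> bool) :
  bijective f -> semi_isometry j ->
  diagonalization M alpha -> diagonalization M' alpha.
Proof.
move=> [f' fK f'K] [[j' jK j'K] jD jZ jf] [phi [[psi phiK psiK] phiE]].
pose th (y : M') : 'rV[S^c]_n := \row_i (f (phi (j' y) 0 i) : S^c).
have j'D y z : j' (y + z) = j' y + j' z.
  by apply: (can_inj jK); rewrite jD !j'K.
have j'Z (a : S^c) y : j' (a *: y) = (f' a : R^c) *: j' y.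
  by apply: (can_inj jK); rewrite jZ !j'K f'K.
have thL : linear th.
  move=> a y z; apply/rowP => i; rewrite !mxE j'D j'Z linearD linearZ !mxE.
  (* Scaling over [S^c] is right multiplication in [S], so [f' a] stands on the right of the
     product. *)
  by rewrite rmorphD; congr (_ + _); rewrite -[LHS]/(f (_ * f' a)) rmorphM f'K.
pose lth := GRing.isLinear.Build _ _ _ _ th thL.
pose Th : {linear M' -> 'rV[S^c]_n} := HB.pack th lth.
exists Th; split=> [|x y].
  exists (fun v : 'rV[S^c]_n => j (psi (\row_i (f' (v 0 i) : R^c)))) => [y|v].
    rewrite -[RHS]j'K -[j' y in RHS]phiK; congr (j (psi _)).
    by apply/rowP => i; rewrite !mxE fK.
  by apply/rowP => i; rewrite !mxE jK psiK mxE f'K.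
rewrite -[x]j'K -[y]j'K jf phiE rmorph_sum; apply: eq_bigr => i _.
by rewrite !mxE !jK !rmorphM rmorph_sign inv_morE.
Qed.
End SemiIsometry.

Lemma semi_isometry_inverse (R S : invRing) e (f : invMor R S) (g : invMor S R)
    (M : herm R e) (M' : herm S e) (j : M -> M') :
  cancel f g -> cancel g f -> semi_isometry f j ->
  exists j' : M' -> M, semi_isometry g j'.
Proof.
move=> fK gK [[j' jK j'K] jD jZ jf]; exists j'; split.
- by exists j.
- by move=> x y; apply: (can_inj jK); rewrite jD !j'K.
- by move=> a x; apply: (can_inj jK); rewrite jZ !j'K gK.
- by move=> x y; apply: (can_inj fK); rewrite -jf !j'K gK.
Qed.

Lemma semi_isometry_diagP (R S : invRing) e (f : invMor R S)
    (M : herm R e) (M' : herm S e) (j : M -> M') n (alpha : 'I_n -> bool) :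
  bijective f -> semi_isometry f j ->
  diagonalization M alpha <-> diagonalization M' alpha.
Proof.
move=> f_bij jP; split; first exact: semi_isometry_diag jP.
have [g [fK gK]] := inv_mor_inverse f_bij.
have [j' j'P] := semi_isometry_inverse fK gK jP.
by apply: semi_isometry_diag j'P; exists f.
Qed.

(** * Isometric forms, functors and the signature *)

Lemma isometric_diagP (R : invRing) e (M N : herm R e) n (alpha : 'I_n -> bool) :
  isometric M N -> diagonalization M alpha <-> diagonalization N alpha.
Proof.
case=> u; apply: (@semi_isometry_diagP _ _ _ (inv_mor_id R) _ _ u).
  by exists idfun.
split; [exact: iso_bij|exact: linearD| |exact: iso_form].
by move=> a x; rewrite linearZ.
Qed.

Lemma isometric_trans (R : invRing) e (M N K : herm R e) :
  isometric M N -> isometric N K -> isometric M K.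
Proof. by move=> [u] [v]; exists; exact: iso_comp v u. Qed.

Lemma fmap_isometric (R S : invRing) e e' (G : hfunctor R S e e')
    (M N : herm R e) : isometric M N -> isometric (G M) (G N).
Proof. by case=> u; exists; exact: fmap. Qed.

Lemma nat_isometric_comp (R S S' T : invRing) e e1 e1' e'
    (F : hfunctor R S e e1) (G : hfunctor S T e1 e')
    (F' : hfunctor R S' e e1') (G' : hfunctor S' T e1' e') :
  nat_isometric (hf_comp G F) (hf_comp G' F') ->
  forall M, isometric (G (F M)) (G' (F' M)).
Proof. by case=> eta _ M; exists; exact: eta. Qed.

(** The vanishing case depends only on [e] and [k]. Otherwise [sign] is chosen by [xget], with
    default 0, from the set of diagonal sums, and equal sets give equal choices. *)
Lemma sign_diag (L1 L2 : rcfType) (k : DKind) e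
    (M : herm (DP L1 k) e) (N : herm (DP L2 k) e) :
  (forall n (alpha : 'I_n -> bool),
    diagonalization M alpha <-> diagonalization N alpha) ->
  sign M = sign N.
Proof.
move=> MN; rewrite /sign; case: ifP => // _; congr xget.
by apply/seteqP; split=> s [n [alpha [/MN]]]; exists n, alpha.
Qed.

(** * Base change on pure tensors and its transitivity *)

Section BaseChangeTheory.
Variables (R S : invRing) (f : invMor R S) (e : bool).

(** The pure tensor [m ⊗ s], with [s] typed in [S] so that the rules below are expressed by products
    in [S] and by [f]. *)
Definition bct (M : herm R e) (m : M) (s : S) : base_change f e M :=
  @mt _ _ _ _ (bc_hbimod f) M m (s : S^c^o).

Section Object.
Variable M : herm R e.

Lemma bctDl (m m' : M) s : bct (m + m') s = bct m s + bct m' s.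
Proof. exact: mtDl. Qed.
Lemma bctDr (m : M) s s' : bct m (s + s') = bct m s + bct m s'.
Proof. exact: mtDr. Qed.
Lemma bctA (m : M) (r : R) s : bct ((r : R^c) *: m) s = bct m (f r * s).
Proof. exact: mtA. Qed.
Lemma bctZ (m : M) (a s : S) : (a : S^c) *: bct m s = bct m (s * a).
Proof. exact: mtZ. Qed.
Lemma bct_form (m m' : M) s s' :
  hform (base_change f e M) (bct m s) (bct m' s') =
  invol s * (f (hform M m m') * s').
Proof. exact: mtformE. Qed.
Lemma bct_ind (Q : base_change f e M -> Prop) :
  Q 0 -> (forall m s t, Q t -> Q (bct m s + t)) -> forall t, Q t.
Proof. exact: tensor_ind. Qed.

(** With [g] inverse to [f], each [m ⊗ s] equals [m g(s) ⊗ 1], so the map is onto; nonsingularity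
    gives injectivity. *)
Lemma bct_semi_isometry : bijective f -> semi_isometry f (fun m : M => bct m 1).
Proof.
move=> f_bij; have [g fK gK] := f_bij; apply: semi_isometry_surj.
- exact: bij_inj.
- by move=> x y; rewrite bctDl.
- by move=> a x; rewrite bctA bctZ mulr1 mul1r.
- by move=> x y; rewrite bct_form invol1 mul1r mulr1.
elim/bct_ind => [|m s t [x xt]].
  exists 0; apply: (addrI (bct (0 : M) 1)).
  by rewrite -bctDl !addr0.
by exists ((g s : R^c) *: m + x); rewrite bctDl bctA gK mulr1 xt.
Qed.
End Object.
End BaseChangeTheory.

Section BaseChangeComp.
Variables (R S T : invRing) (f : invMor R S) (g : invMor S T) (gf : invMor R T).
Hypothesis gfE : g \o f =1 gf.
Variables (e : bool) (M : herm R e).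

Let M2 := base_change g e (base_change f e M).

(** The isometry is [m ⊗ t ↦ (m ⊗ 1) ⊗ t]. It preserves the forms, hence is injective, and it is
    onto because [(m ⊗ s) ⊗ t = (m ⊗ 1) ⊗ g(s) t]. *)
Lemma base_change_comp : isometric (base_change gf e M) M2.
Proof.
pose b (m : M) (t : T^c^o) : M2 := bct g (bct f m 1) (t : T).
have bal : balanced (@mract _ _ M) (lact (bc_hbimod gf)) b.
  split=> [t m m'|m t t'|m r t]; rewrite /b.
  - by rewrite bctDl bctDl.
  - by rewrite bctDr.
  (* Write [m ⊗ f r] as [(m ⊗ 1) (f r)]; the scalar then crosses the outer tensor sign as
     [g (f r)]. *)
  rewrite /mract bctA mulr1 -[f r]mul1r -bctZ bctA.
  by rewrite -[g (f r)]/((g \o f) r) gfE.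
pose u : base_change gf e M -> M2 := tlift b.
have uE m t : u (bct gf m t) = bct g (bct f m 1) t.
  exact: (tliftE _ _ bal).
have uD : {morph u : x y / x + y} by exact: (tliftD bal).
have u0 : u 0 = 0 by apply: (addrI (u 0)); rewrite -uD !addr0.
have uZ (a : T) x : u ((a : T^c) *: x) = (a : T^c) *: u x.
  elim/bct_ind: x => [|m t x IH]; first by rewrite !scaler0 u0 scaler0.
  by rewrite scalerDr !uD scalerDr IH bctZ !uE bctZ.
have uf x y : hform M2 (u x) (u y) = hform (base_change gf e M) x y.
  have hM2 := hermP M2; have hM := hermP (base_change gf e M).
  elim/bct_ind: x => [|m t x IHx]; first by rewrite u0 (eh0l hM2) (eh0l hM).
  rewrite uD (ehDl hM2) (ehDl hM) {}IHx uE; congr (_ + _).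
  elim/bct_ind: y => [|m' t' y IHy]; first by rewrite u0 (eh0r hM2) (eh0r hM).
  rewrite uD (ehDr hM2) (ehDr hM) {}IHy uE; congr (_ + _).
  by rewrite !bct_form -gfE /= invol1 mul1r mulr1.
have u_surj y : exists x, u x = y.
  elim/bct_ind: y => [|z t y [x xy]]; first by exists 0.
  suff [x' x'z] : exists x', u x' = bct g z t.
    by exists (x' + x); rewrite uD x'z xy.
  elim/bct_ind: z => [|m s z [x' x'z]].
    exists 0; rewrite u0; apply: (addrI (bct g 0 t)).
    by rewrite -bctDl !addr0.
  exists (bct gf m (g s * t) + x'); rewrite uD x'z uE bctDl; congr (_ + _).
  by rewrite -bctA bctZ mul1r.
(* Viewing [u] as semilinear along the identity of [T] turns surjectivity into bijectivity. *)
have [u_bij _ _ _] :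
    @semi_isometry _ _ _ (inv_mor_id T) (base_change gf e M) M2 u.
  by apply: semi_isometry_surj => // x y.
pose lu := GRing.isLinear.Build _ _ _ _ u (fun a x y =>
  etrans (uD _ _) (congr1 (fun z => z + u y) (uZ a x))).
pose U : {linear base_change gf e M -> M2} := HB.pack u lu.
by exists; exact: (@Isometry _ _ _ _ U u_bij uf).
Qed.
End BaseChangeComp.

(** * Transport along an isomorphism of real closures *)

(** [G'] sends the transitivity isometry to one from [G' (gf^* h)] to [G' (g^* (f^* h))]; the
    natural isometry at [f^* h] then leads to [r^* (G (f^* h))]. *)
Lemma base_change_transport (R S S' D D' : invRing) e e'
    (f : invMor R S) (g : invMor S S') (gf : invMor R S') (r : invMor D D')
    (G : hfunctor S D e e') (G' : hfunctor S' D' e e') :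
  g \o f =1 gf ->
  nat_isometric (hf_comp G' (base_change g e)) (hf_comp (base_change r e') G) ->
  forall h, isometric (G' (base_change gf e h))
                      (base_change r e' (G (base_change f e h))).
Proof.
move=> gfE GG' h.
apply: (@isometric_trans _ _ _ (G' (base_change g e (base_change f e h)))).
  exact/fmap_isometric/base_change_comp.
exact: nat_isometric_comp GG' _.
Qed.

Lemma DP_map_bij (L1 L2 : rcfType) (rho : {rmorphism L1 -> L2}) k :
  bijective rho -> bijective (DP_mor rho k).
Proof.
move=> [rho' rhoK rho'K].
case: k => /=.
- by exists rho'.
- by exists (fun x : quat L2 =>
    Quat (rho' (q1 x)) (rho' (qi x)) (rho' (qj x)) (rho' (qk x)));
    case=> a b c d; rewrite /= ?rhoK ?rho'K.
- by exists (fun x : complex.complex L2 =>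
    complex.Complex (rho' (complex.Re x)) (rho' (complex.Im x)));
    case=> a b; rewrite /= ?rhoK ?rho'K.
- by exists (fun x : L2 * L2 => (rho' x.1, rho' x.2));
    case=> a b; rewrite /= ?rhoK ?rho'K.
Qed.

Theorem proposition3p3
  (F : fieldType) (F_real : formally_real F)
  (A : algInvol F) (P : ordering F)
  (L1 L2 : rcfType) (iota1 : realClosure P L1) (iota2 : realClosure P L2)
  (k : DKind) (Dk : is_DP A iota1 k)
  (M1 : moritaEq (ext_invRing A iota1) (DP L1 k) (epsP A k))
  (rho : {rmorphism L1 -> L2}) (rho_bij : bijective rho)
  (rho_iota : rho \o iota1 =1 iota2)
  (rhoM1 : moritaEq (ext_invRing A iota2) (DP L2 k) (epsP A k))
  (rhoM1P : transports rho_iota M1 rhoM1)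
  (w : witt (ai_invRing A) false) (h : herm (ai_invRing A) false)
  (hw : witt_class w h) :
  msign M1 h = msign rhoM1 h.
Proof.
(* On [a], both sides reduce to [a ⊗ 1] because [rho] fixes 1. *)
have ext_comp : idtens_mor A rho_iota \o ext_mor A iota1 =1 ext_mor A iota2.
  move=> a; have rho1 : pure iota2 a (rho 1) = pure iota2 a 1.
    by congr pure; exact: rmorph1.
  exact: etrans (idtensE rho_iota a 1) rho1.
(* [rhoM1 (h ⊗ L2)] is isometric to [rho^* (M1 (h ⊗ L1))]. *)
have iso := base_change_transport ext_comp rhoM1P h.
have bij := DP_map_bij k rho_bij.
have semi := bct_semi_isometry (M1 (extend A iota1 h)) bij.
apply: sign_diag => n alpha.
apply: iff_trans (semi_isometry_diagP alpha bij semi) _.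
exact: iff_sym (isometric_diagP alpha iso).
Qed.
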